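(* For any domain $\Omega$ in $\mathbb{H}$, the function space $\mathrm{Reg}_{(1,3)}(\Omega,\mathbb{H})$ of $(1,3)$-regular functions is distinct both from the space $\mathrm{Reg}_{3}(\Omega,\mathbb{H})$ of left Fueter-regular functions and from the space $\mathrm{Reg}_{(0,3)}(\Omega,\mathbb{H})$ of slice-regular quaternionic functions.
   Context: $\mathbb{H}=\mathbb{R}+i\mathbb{R}+j\mathbb{R}+k\mathbb{R}$ is the algebra of real quaternions, with variable $x=x_0+ix_1+jx_2+kx_3$. A domain $\Omega$ in $\mathbb{H}$ is a nonempty connected open subset. Let $f:\Omega\to\mathbb{H}$. - $(1,3)$-regular: let $\mathbb{S}^1:=\{jb+kc: b,c\in\mathbb{R},\ b^2+c^2=1\}$ and, for $J\in\mathbb{S}^1$, $\mathbb{R}^{2+1}_J:=\mathrm{Span}_{\mathbb{R}}(1,i,J)$ with points $x_0+ix_1+\beta J$. The function $f$ is $(1,3)$-regular if, for every $J\in\mathbb{S}^1$, the restriction of $f$ to $\Omega\cap\mathbb{R}^{2+1}_J$ is $C^1$ and satisfies $(\partial_{x_0}+i\partial_{x_1}+J\partial_\beta)f(x_0+ix_1+\beta J)\equiv0$. - Left Fueter-regular ($3$-regular): $f$ is $C^1$ and $(\partial_{x_0}+i\partial_{x_1}+j\partial_{x_2}+k\partial_{x_3})f\equiv0$ on $\Omega$. - Slice-regular ($(0,3)$-regular): for every quaternion $J$ with zero real part and $|J|=1$, the restriction of $f$ to $\Omega\cap(\mathbb{R}+J\mathbb{R})$ is $C^1$ and satisfies $(\partial_\alpha+J\partial_\beta)f(\alpha+\beta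 J)\equiv0$. *)

(* Defs.v *)
From HB Require Import structures.
From mathcomp Require Import all_boot all_order all_algebra.
From mathcomp Require Import all_classical all_reals all_analysis.
From mathcomp Require Import ring.
Set Implicit Arguments.
Unset Strict Implicit.
Unset Printing Implicit Defensive.
Import Order.TTheory GRing.Theory Num.Theory.
Import numFieldNormedType.Exports.
Local Open Scope classical_set_scope.
Local Open Scope ring_scope.

(* The quaternion x0 + i x1 + j x2 + k x3 is the row vector (x0, x1, x2, x3).
   The norm `|x| inherited from 'rV[R]_4 is the sup norm: it is only used
   through the (Euclidean) topology it induces; the modulus of a quaternion
   is qnorm below. *)
Definition quat (R : realType) := 'rV[R]_4.

HB.instance Definition _ (R : realType) :=
  NormedModule.copy (quat R) 'rV[R]_4.

Section QuaternionAlgebra.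
Variable R : realType.
Implicit Types x y z : quat R.

Definition mkquat (a b c d : R) : quat R := \row_s [:: a; b; c; d]`_s.

Definition q0 x : R := x ord0 (inord 0).
Definition q1 x : R := x ord0 (inord 1).
Definition q2 x : R := x ord0 (inord 2).
Definition q3 x : R := x ord0 (inord 3).

Definition mulq x y : quat R :=
  mkquat (q0 x * q0 y - q1 x * q1 y - q2 x * q2 y - q3 x * q3 y)
         (q0 x * q1 y + q1 x * q0 y + q2 x * q3 y - q3 x * q2 y)
         (q0 x * q2 y - q1 x * q3 y + q2 x * q0 y + q3 x * q1 y)
         (q0 x * q3 y + q1 x * q2 y - q2 x * q1 y + q3 x * q0 y).

Definition oneq : quat R := mkquat 1 0 0 0.

Lemma quatP x y :
  q0 x = q0 y -> q1 x = q1 y -> q2 x = q2 y -> q3 x = q3 y -> x = y.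
Proof.
move=> e0 e1 e2 e3; apply/rowP => -[[|[|[|[|//]]]] ?].
- by move: e0; congr (_ = _); congr (_ _ _); apply/val_inj; rewrite /= inordK.
- by move: e1; congr (_ = _); congr (_ _ _); apply/val_inj; rewrite /= inordK.
- by move: e2; congr (_ = _); congr (_ _ _); apply/val_inj; rewrite /= inordK.
- by move: e3; congr (_ = _); congr (_ _ _); apply/val_inj; rewrite /= inordK.
Qed.

Lemma mkquatE a b c d :
  (q0 (mkquat a b c d) = a) * (q1 (mkquat a b c d) = b) *
  (q2 (mkquat a b c d) = c) * (q3 (mkquat a b c d) = d).
Proof. by rewrite /q0 /q1 /q2 /q3 !mxE !inordK. Qed.

Lemma addqE x y :
  (q0 (x + y) = q0 x + q0 y) * (q1 (x + y) = q1 x + q1 y) *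
  (q2 (x + y) = q2 x + q2 y) * (q3 (x + y) = q3 x + q3 y).
Proof. by rewrite /q0 /q1 /q2 /q3 !mxE. Qed.

Lemma scaleqE (a : R) x :
  (q0 (a *: x) = a * q0 x) * (q1 (a *: x) = a * q1 x) *
  (q2 (a *: x) = a * q2 x) * (q3 (a *: x) = a * q3 x).
Proof. by rewrite /q0 /q1 /q2 /q3 !mxE. Qed.

Lemma mulqA : associative mulq.
Proof. by move=> x y z; apply: quatP; rewrite /mulq !mkquatE; ring. Qed.

Lemma mul1q : left_id oneq mulq.
Proof. by move=> x; apply: quatP; rewrite /mulq /oneq !mkquatE; ring. Qed.

Lemma mulq1 : right_id oneq mulq.
Proof. by move=> x; apply: quatP; rewrite /mulq /oneq !mkquatE; ring. Qed.

Lemma mulqDl : left_distributive mulq +%R.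
Proof.
by move=> x y z; apply: quatP; rewrite /mulq !(mkquatE, addqE); ring.
Qed.

Lemma mulqDr : right_distributive mulq +%R.
Proof.
by move=> x y z; apply: quatP; rewrite /mulq !(mkquatE, addqE); ring.
Qed.

Lemma oneq_neq0 : oneq != 0.
Proof.
apply/eqP => /(congr1 q0); rewrite /oneq mkquatE /q0 mxE => /eqP.
by rewrite oner_eq0.
Qed.

HB.instance Definition _ := GRing.Zmodule_isNzRing.Build (quat R)
  mulqA mul1q mulq1 mulqDl mulqDr oneq_neq0.

Lemma scaleqAl (a : R) x y : a *: (x * y) = a *: x * y.
Proof.
apply: quatP; rewrite /GRing.mul /= /mulq !(mkquatE, scaleqE); ring.
Qed.

Lemma scaleqAr (a : R) x y : a *: (x * y) = x * (a *: y).
Proof.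
apply: quatP; rewrite /GRing.mul /= /mulq !(mkquatE, scaleqE); ring.
Qed.

HB.instance Definition _ := GRing.Lmodule_isLalgebra.Build R (quat R) scaleqAl.
HB.instance Definition _ := GRing.Lalgebra_isAlgebra.Build R (quat R) scaleqAr.

Definition qi : quat R := mkquat 0 1 0 0.
Definition qj : quat R := mkquat 0 0 1 0.
Definition qk : quat R := mkquat 0 0 0 1.

Definition qnorm x : R :=
  Num.sqrt (q0 x ^+ 2 + q1 x ^+ 2 + q2 x ^+ 2 + q3 x ^+ 2).

Definition sphere1 : set (quat R) :=
  [set J | exists b c : R, b ^+ 2 + c ^+ 2 = 1 /\ J = b *: qj + c *: qk].

Definition sphere2 : set (quat R) := [set J | q0 J = 0 /\ qnorm J = 1].

End QuaternionAlgebra.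

Section Regularity.
Variable R : realType.

Definition domain (Omega : set (quat R)) : Prop :=
  [/\ Omega !=set0, connected Omega & open Omega].

Section Frame.
Variables (n : nat) (v : n.+1.-tuple (quat R)).

(* (t_0, ..., t_n) |-> t_0 v_0 + ... + t_n v_n *)
Definition frame_map (t : 'rV[R]_n.+1) : quat R :=
  \sum_s t ord0 s *: tnth v s.

Definition partial (s : 'I_n.+1) (g : 'rV[R]_n.+1 -> quat R) :
  'rV[R]_n.+1 -> quat R := 'D_(delta_mx ord0 s) g.

(* C^1 in the classical sense; meant for open sets U *)
Definition C1_on (U : set 'rV[R]_n.+1) (g : 'rV[R]_n.+1 -> quat R) : Prop :=
  forall s t, U t ->
    derivable g t (delta_mx ord0 s) /\ {for t, continuous (partial s g)}.

(* f, written in the coordinates t of the span of the linearly independent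
   family v, is C^1 and is annihilated by sum_s v_s d/dt_s (the coefficients
   acting by left multiplication).  The extension of f by 0 outside Omega is
   immaterial, as frame_map @^-1` Omega is open when Omega is. *)
Definition monogenic_along (Omega : set (quat R)) (f : Omega -> quat R) :=
  let U := frame_map @^-1` Omega in
  let g := 'valL_0 f \o frame_map in
  C1_on U g /\ forall t, U t -> \sum_s tnth v s * partial s g t = 0.

End Frame.

Definition Reg_1_3 (Omega : set (quat R)) : set (Omega -> quat R) :=
  [set f | forall J, @sphere1 R J -> monogenic_along [tuple 1; @qi R; J] f].

Definition Reg_3 (Omega : set (quat R)) : set (Omega -> quat R) :=
  [set f | monogenic_along [tuple 1; @qi R; @qj R; @qk R] f].

Definition Reg_0_3 (Omega : set (quat R)) : set (Omega -> quat R) :=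
  [set f | forall J, @sphere2 R J -> monogenic_along [tuple 1; J] f].

End Regularity.

Arguments Reg_1_3 {R} Omega _.
Arguments Reg_3 {R} Omega _.
Arguments Reg_0_3 {R} Omega _.

(* Main.v *)
Require Import Defs.
From mathcomp Require Import all_boot all_order all_algebra.
From mathcomp Require Import all_classical all_reals all_analysis.
From HB Require Import structures.
From mathcomp Require Import ring.
Set Implicit Arguments.
Unset Strict Implicit.
Unset Printing Implicit Defensive.
Import Order.TTheory GRing.Theory Num.Theory.
Import numFieldNormedType.Exports.
Local Open Scope classical_set_scope.
Local Open Scope ring_scope.

(** Both spaces are told apart by (the restriction to Omega of) a real-linear
    function L.  All partial derivatives of a linear function are constant, so
    in the coordinates of a frame v it is monogenic exactly when the single
    quaternion \sum_s v_s * L v_s vanishes, unless the span of v misses Omega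
    ([monogenic_along_linear]).

    - [fueterL], the function x |-> x3 k - x2 j, is Fueter-regular because
      j (-j) + k k = 0.  Along the frame (1, i, J) with J = b j + c k the sum is
      J (c k - b j), a product of two unit quaternions, which is never 0.

    - The identity is slice-regular because 1 + J J = 0 for every imaginary
      unit J.  Along (1, i, J) the sum is 1 + i i + J J = -1.

    In both cases every single J in the circle obstructs (1,3)-regularity,
    provided the 3-space of J meets Omega.  As these 3-spaces cover the whole
    algebra ([mem_frame_sphere1]), any point of Omega supplies such a J. *)

(** The difference quotients of a linear map are constant; hence it has
    directional derivatives even if it is not continuous. *)
Lemma linear_derive (R : numFieldType) (V W : normedModType R)
    (L : {linear V -> W}) (t v : V) :
  derivable L t v /\ 'D_v L t = L v.
Proof.
suff cv : (h^-1 *: ((L \o shift t) (h *: v) - L t)) @[h --> 0^'] --> L v.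
  by split; [apply/cvg_ex; exists (L v) | apply: cvg_lim].
apply: cvg_near_cst; near=> h.
rewrite /= (linearD L) addrK (linearZ_LR L) scalerA mulVf ?scale1r //.
near: h; exact: nbhs_dnbhs_neq.
Unshelve. all: by end_near. Qed.

Section LinearAlongFrame.
Variables (R : realType) (n : nat) (v : n.+1.-tuple (quat R)).

Lemma frame_map_linear : linear (frame_map v).
Proof.
move=> a t u; rewrite /frame_map scaler_sumr -big_split; apply: eq_bigr => s _.
by rewrite !mxE scalerDl scalerA.
Qed.

HB.instance Definition _ :=
  GRing.isLinear.Build R 'rV[R]_n.+1 (quat R) _ (frame_map v) frame_map_linear.

Lemma frame_map_delta s : frame_map v (delta_mx ord0 s) = tnth v s.
Proof.
rewrite /frame_map (bigD1 s) //= mxE !eqxx scale1r big1 ?addr0 // => r rs.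
by rewrite mxE (negPf rs) andbF scale0r.
Qed.

Lemma continuous_frame_map : continuous (frame_map v).
Proof.
rewrite /frame_map; apply: continuous_big => [|s _ t]; first exact: add_continuous.
exact: cvgZl (@coord_continuous R 1 n.+1 ord0 s t).
Qed.

Lemma near_frame_map (Omega : set (quat R)) (t : 'rV[R]_n.+1) :
  open Omega -> Omega (frame_map v t) -> \forall u \near t, Omega (frame_map v u).
Proof.
by move=> oO Ot; apply: continuous_frame_map; exact: open_nbhs_nbhs (conj oO Ot).
Qed.

Lemma partial_linear (Omega : set (quat R)) (L : {linear quat R -> quat R})
    (s : 'I_n.+1) (t : 'rV[R]_n.+1) :
  open Omega -> Omega (frame_map v t) ->
  let g := 'valL_0 (sigL Omega L) \o frame_map v in
  derivable g t (delta_mx ord0 s) /\ partial s g t = L (tnth v s).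
Proof.
move=> oO Ot g.
have gE : {near t, (L \o frame_map v) =1 g}.
  near=> u; have Ou : Omega (frame_map v u).
    by near: u; exact: near_frame_map.
  rewrite /g /comp -[RHS]/(('valL_0 \o sigL Omega) L (frame_map v u)) sigLK.
  by rewrite patchT // inE.
have [dL DL] := linear_derive (L \o frame_map v) t (delta_mx ord0 s).
split; first exact: near_eq_derivable gE dL.
by rewrite /partial -(near_eq_derive _ gE) [LHS]DL /= frame_map_delta.
Unshelve. all: by end_near. Qed.

(** Shifting the point of Omega does not change the equation, so it is a
    condition on L alone; C^1-smoothness is automatic, the partial derivatives
    being constant on an open set. *)
Lemma monogenic_along_linear (Omega : set (quat R))
    (L : {linear quat R -> quat R}) :
  open Omega ->
  monogenic_along v (sigL Omega L) <->
  (frame_map v @^-1` Omega !=set0 -> \sum_s tnth v s * L (tnth v s) = 0).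
Proof.
move=> oO; set g := 'valL_0 (sigL Omega L) \o frame_map v.
split=> [[_ eq0] [t Ot]|eq0].
  rewrite -[RHS](eq0 t Ot); apply: eq_bigr => s _.
  by rewrite (partial_linear L s oO Ot).2.
split=> [s t Ot|t Ot]; last first.
  rewrite -[RHS]eq0; last by exists t.
  by apply: eq_bigr => s _; rewrite (partial_linear L s oO Ot).2.
split; first exact: (partial_linear L s oO Ot).1.
have cst : \forall u \near t, partial s g u = L (tnth v s).
  near=> u; apply: (partial_linear L s oO _).2.
  by near: u; exact: near_frame_map.
rewrite /prop_for /continuous_at (partial_linear L s oO Ot).2.
exact: (cvg_near_cst _ cst).
Unshelve. all: by end_near. Qed.

End LinearAlongFrame.

Section Witnesses.
Variable R : realType.
Implicit Types (x J : quat R) (Omega : set (quat R)).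

Lemma mulqE x y :
  x * y = mkquat
    (q0 x * q0 y - q1 x * q1 y - q2 x * q2 y - q3 x * q3 y)
    (q0 x * q1 y + q1 x * q0 y + q2 x * q3 y - q3 x * q2 y)
    (q0 x * q2 y - q1 x * q3 y + q2 x * q0 y + q3 x * q1 y)
    (q0 x * q3 y + q1 x * q2 y - q2 x * q1 y + q3 x * q0 y).
Proof. by []. Qed.

Lemma onequatE : 1 = mkquat 1 0 0 0 :> quat R.
Proof. by []. Qed.

Lemma zeroqE :
  (q0 (0 : quat R) = 0) * (q1 (0 : quat R) = 0) *
  (q2 (0 : quat R) = 0) * (q3 (0 : quat R) = 0).
Proof. by rewrite /q0 /q1 /q2 /q3 !mxE. Qed.

Lemma oppqE x :
  (q0 (- x) = - q0 x) * (q1 (- x) = - q1 x) *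
  (q2 (- x) = - q2 x) * (q3 (- x) = - q3 x).
Proof. by rewrite /q0 /q1 /q2 /q3 !mxE. Qed.

Definition quatE :=
  (mkquatE, addqE, scaleqE, oppqE, zeroqE, mulqE, onequatE).

Lemma sum_frame3 J (L : quat R -> quat R) :
  \sum_s tnth [tuple 1; @qi R; J] s * L (tnth [tuple 1; @qi R; J] s)
  = L 1 + @qi R * L (@qi R) + J * L J.
Proof. by rewrite !big_ord_recl big_ord0 /= !(tnth_nth 0) /= mul1r addr0 addrA. Qed.

(** In polar form x2 j + x3 k = r J, so that x = x0 + i x1 + r J. *)
Lemma mem_frame_sphere1 x :
  exists2 J, @sphere1 R J & exists t, frame_map [tuple 1; @qi R; J] t = x.
Proof.
pose r := Num.sqrt (q2 x ^+ 2 + q3 x ^+ 2).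
have r2 : r ^+ 2 = q2 x ^+ 2 + q3 x ^+ 2.
  by rewrite sqr_sqrtr // addr_ge0 // sqr_ge0.
have [b [c [bc1 [bx cx]]]] : exists b c : R,
    b ^+ 2 + c ^+ 2 = 1 /\ r * b = q2 x /\ r * c = q3 x.
  have [r0|r_neq0] := eqVneq r 0.
    (* on the plane x2 = x3 = 0 any J will do *)
    exists 1, 0; rewrite expr1n expr0n addr0; split=> //.
    move/eqP: r2; rewrite r0 expr0n eq_sym paddr_eq0 ?sqr_ge0 // !sqrf_eq0.
    by case/andP => /eqP -> /eqP ->; rewrite !mul0r.
  exists (q2 x / r), (q3 x / r); split; last by split; rewrite mulrCA mulfV ?mulr1.
  by rewrite !exprMn -mulrDl -r2 exprVn mulfV ?expf_neq0.
exists (b *: @qj R + c *: @qk R); first by exists b, c.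
exists (\row_s [:: q0 x; q1 x; r]`_s).
rewrite /frame_map !big_ord_recl big_ord0 /= !(tnth_nth 0) !mxE /= addr0.
by apply: quatP; rewrite /qi /qj /qk !quatE -?bx -?cx; ring.
Qed.

(** The conclusion is only about some J because the condition at J is void
    when the 3-space of J misses Omega; a J whose 3-space contains a chosen
    point of Omega gives a genuine equation. *)
Lemma Reg_1_3_linear Omega (L : {linear quat R -> quat R}) :
  domain Omega -> Reg_1_3 Omega (sigL Omega L) ->
  exists2 J, @sphere1 R J & L 1 + @qi R * L (@qi R) + J * L J = 0.
Proof.
move=> [[x Ox] _ oO] regL; have [J sJ [t tx]] := mem_frame_sphere1 x.
exists J => //; rewrite -sum_frame3.
apply: (monogenic_along_linear _ L oO).1; first exact: regL.
by exists t; rewrite /preimage /= tx.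
Qed.

Definition fueterL x : quat R := q3 x *: @qk R - q2 x *: @qj R.

Lemma fueterL_linear : linear fueterL.
Proof.
by move=> a x y; apply: quatP; rewrite /fueterL /qj /qk !quatE; ring.
Qed.

HB.instance Definition _ :=
  GRing.isLinear.Build R (quat R) (quat R) _ fueterL fueterL_linear.

Lemma Reg_3_fueterL Omega : open Omega -> Reg_3 Omega (sigL Omega fueterL).
Proof.
move=> oO; apply/(monogenic_along_linear _ fueterL oO) => _.
rewrite !big_ord_recl big_ord0 /= !(tnth_nth 0) /=.
by apply: quatP; rewrite /fueterL /qi /qj /qk !quatE; ring.
Qed.

Lemma not_Reg_1_3_fueterL Omega :
  domain Omega -> ~ Reg_1_3 Omega (sigL Omega fueterL).
Proof.
move=> dO /(Reg_1_3_linear dO)[_ [b [c [bc1 ->]]]].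
set J := _ + _ => eq0.
(* J * fueterL J = (b ^+ 2 - c ^+ 2) + (b * c *+ 2) i, of modulus b^2 + c^2 *)
have e0 : b ^+ 2 - c ^+ 2 = 0.
  move/(congr1 (@q0 R)): eq0; rewrite /J /fueterL /qi /qj /qk !quatE => <-.
  by ring.
have e1 : b * c *+ 2 = 0.
  move/(congr1 (@q1 R)): eq0; rewrite /J /fueterL /qi /qj /qk !quatE => <-.
  by ring.
suff : (b ^+ 2 + c ^+ 2) ^+ 2 = 0 by rewrite bc1 expr1n => /eqP; rewrite oner_eq0.
have -> : (b ^+ 2 + c ^+ 2) ^+ 2 = (b ^+ 2 - c ^+ 2) ^+ 2 + (b * c *+ 2) ^+ 2.
  by ring.
by rewrite e0 e1 expr0n addr0.
Qed.

Lemma sqr_sphere2 J : @sphere2 R J -> J * J = -1.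
Proof.
case=> J0 J1; have e : q1 J ^+ 2 + q2 J ^+ 2 + q3 J ^+ 2 = 1.
  have /(congr1 (fun a => a ^+ 2)) := J1; rewrite /qnorm J0 expr0n add0r expr1n.
  by rewrite sqr_sqrtr // !addr_ge0 // sqr_ge0.
by apply: quatP; rewrite !quatE J0 -?e; ring.
Qed.

Lemma sphere1_sphere2 J : @sphere1 R J -> @sphere2 R J.
Proof.
move=> [b [c [bc1 ->]]]; rewrite /sphere2 /= /qnorm /qj /qk !quatE.
split; first by ring.
by rewrite !(mulr0, mulr1, addr0, add0r) expr0n !add0r bc1 sqrtr1.
Qed.

Lemma Reg_0_3_id Omega : open Omega -> Reg_0_3 Omega (sigL Omega idfun).
Proof.
move=> oO J sJ; apply/(monogenic_along_linear _ idfun oO) => _.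
rewrite !big_ord_recl big_ord0 /= !(tnth_nth 0) /= mulr1 addr0.
by rewrite sqr_sphere2 // subrr.
Qed.

Lemma not_Reg_1_3_id Omega : domain Omega -> ~ Reg_1_3 Omega (sigL Omega idfun).
Proof.
move=> dO /(Reg_1_3_linear dO)[J sJ] /=.
have -> : @qi R * @qi R = -1.
  by apply: quatP; rewrite /qi !quatE; ring.
rewrite (sqr_sphere2 (sphere1_sphere2 sJ)) subrr add0r => /eqP.
by rewrite oppr_eq0 oner_eq0.
Qed.

End Witnesses.

Theorem corollary4p8 (R : realType) (Omega : set (quat R)) :
  domain Omega ->
  Reg_1_3 Omega <> Reg_3 Omega /\ Reg_1_3 Omega <> Reg_0_3 Omega.
Proof.
move=> dO; have [_ _ oO] := dO; split=> eqReg.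
- by apply: (not_Reg_1_3_fueterL dO); rewrite eqReg; exact: Reg_3_fueterL.
- by apply: (not_Reg_1_3_id dO); rewrite eqReg; exact: Reg_0_3_id.
Qed.
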